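(* For any virtual knot $K$ with crossing number $c$, $$F(K) \leq \left\lfloor \frac{3c^2-6c+7}{4} \right\rfloor,$$ where $F(K)$ is the forbidden number of $K$.
   Context: A virtual knot is an equivalence class of (oriented) virtual knot diagrams, with classical and virtual crossings, modulo the extended Reidemeister moves: the classical moves $R1,R2,R3$, the virtual moves $V1,V2,V3$ and the semivirtual move $SV$. The Gauss diagram of a diagram is an oriented circle with one signed arrow (chord) per classical crossing; the two endpoints of the arrow are the two passages through that crossing, the arrow points from the overcrossing (tail) to the undercrossing (head), and it carries the sign $\pm1$ of the crossing. The moves $V1,V2,V3,SV$ do not change the Gauss diagram, every Gauss diagram is realized by a virtual knot diagram, and virtual knots correspond to Gauss diagrams modulo the Gauss diagram versions of $R1,R2,R3$. The forbidden moves: $FO$ moves a strand of the diagram over a virtual crossing; on Gauss diagrams it interchanges two adjacent tails of two different arrows. $FU$ moves a strand under a virtual crossing; on Gauss diagrams it interchanges two adjacent heads of two different arrows. Signs of arrows are arbitrary and unchanged in both moves. The forbidden number $F(K)$ is the minimum number of forbidden moves needed to transform $K$ into the unknot, taken over all diagrams of $K$ and with unlimited use of extended Reidemeister moves. The crossing number of $K$ is the minimum number of classical (non-virtual) crossings in any diagram of $K$, i.e. the minimum number of arrows in any Gauss diagram of $K$. *)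

(* Defs.v *)
From mathcomp Require Import all_boot.
From Stdlib Require Import Relations.

Set Implicit Arguments.
Unset Strict Implicit.
Unset Printing Implicit Defensive.

(* An arrow is a label with a sign ([true] for +1, [false] for -1). *)
Definition arrow : Type := (nat * bool)%type.
Definition label (x : arrow) : nat := x.1.
Definition sgn (x : arrow) : bool := x.2.

(* [(x, true)] is the tail of [x] (overcrossing passage), [(x, false)] is its
   head (undercrossing passage). *)
Definition endpoint : Type := (arrow * bool)%type.
Definition arrow_tail (x : arrow) : endpoint := (x, true).
Definition arrow_head (x : arrow) : endpoint := (x, false).
Definition opposite (e : endpoint) : endpoint := (e.1, ~~ e.2).

(* A Gauss diagram is read as the word of its arrow endpoints, following the
   oriented circle from a base point.  Each label that occurs has exactly one
   tail and one head, carrying the same sign. *)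
Definition is_gauss (w : seq endpoint) : bool :=
  uniq [seq (label e.1, e.2) | e <- w] && all [pred e | opposite e \in w] w.

Definition gauss_diagram : Type := {w : seq endpoint | is_gauss w}.

Definition arrow_count (D : gauss_diagram) : nat :=
  count (fun e : endpoint => e.2) (val D).

Definition empty_diagram : gauss_diagram := exist _ [::] isT.

(* Two words describe the same Gauss diagram when they differ by the choice of
   base point and of arrow labels. *)
Definition relabel (f : nat -> nat) (e : endpoint) : endpoint :=
  ((f (label e.1), sgn e.1), e.2).

Inductive same_diagram : seq endpoint -> seq endpoint -> Prop :=
| Rotate u v : same_diagram (u ++ v) (v ++ u)
| Relabel f u : injective f -> same_diagram u (map (relabel f) u).

Definition in_order (b : bool) (e e' : endpoint) : seq endpoint :=
  if b then [:: e; e'] else [:: e'; e].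

(* The three strands in an R3 move: x is the crossing top/middle, y is
   top/bottom and z is middle/bottom.  For three straight lines, the sign of a
   crossing is that of the determinant of the directions (over, under).  With
   x at the origin and bottom line {p | det (p, d_bottom) = h}, h <> 0, the top
   line meets x before y iff h * sgn y > 0, the middle line meets x before z
   iff h * sgn z > 0, and the bottom line meets y before z iff
   h * sgn x * sgn y * sgn z > 0.  The move changes the sign of h, which
   reverses all three orders.  In each product the number of factors is even,
   so positivity is the negation of the exclusive or; the negation is absorbed
   in the boolean [h] below. *)
Definition top_strand (h : bool) (x y z : arrow) : seq endpoint :=
  in_order (h (+) sgn y) (arrow_tail x) (arrow_tail y).
Definition middle_strand (h : bool) (x y z : arrow) : seq endpoint :=
  in_order (h (+) sgn z) (arrow_head x) (arrow_tail z).
Definition bottom_strand (h : bool) (x y z : arrow) : seq endpoint :=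
  in_order (h (+) sgn x (+) sgn y (+) sgn z) (arrow_head y) (arrow_head z).

(* The moves are written with the base point just before one of the strands
   involved; the other positions come from [Rotate].  Labels are fresh or
   distinct where needed because both sides have to be Gauss diagrams.  The
   two cases of R2 (resp. R3) are the two relative directions of the strands
   (resp. the two cyclic orders in which the knot runs through them). *)
Inductive reidemeister : seq endpoint -> seq endpoint -> Prop :=
| R1 e u :
    reidemeister u (e :: opposite e :: u)
| R2_parallel x y u v : sgn y = ~~ sgn x ->
    reidemeister (u ++ v)
      ([:: arrow_tail x; arrow_tail y] ++ u ++ [:: arrow_head x; arrow_head y] ++ v)
| R2_antiparallel x y u v : sgn y = ~~ sgn x ->
    reidemeister (u ++ v)
      ([:: arrow_tail x; arrow_tail y] ++ u ++ [:: arrow_head y; arrow_head x] ++ v)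
| R3_tmb h x y z u v w :
    reidemeister
      (top_strand h x y z ++ u ++ middle_strand h x y z ++ v ++
         bottom_strand h x y z ++ w)
      (top_strand (~~ h) x y z ++ u ++ middle_strand (~~ h) x y z ++ v ++
         bottom_strand (~~ h) x y z ++ w)
| R3_tbm h x y z u v w :
    reidemeister
      (top_strand h x y z ++ u ++ bottom_strand h x y z ++ v ++
         middle_strand h x y z ++ w)
      (top_strand (~~ h) x y z ++ u ++ bottom_strand (~~ h) x y z ++ v ++
         middle_strand (~~ h) x y z ++ w).

Inductive forbidden : seq endpoint -> seq endpoint -> Prop :=
| FO x y u : forbidden ([:: arrow_tail x; arrow_tail y] ++ u) ([:: arrow_tail y; arrow_tail x] ++ u)
| FU x y u : forbidden ([:: arrow_head x; arrow_head y] ++ u) ([:: arrow_head y; arrow_head x] ++ u).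

Definition knot_step (D D' : gauss_diagram) : Prop :=
  same_diagram (val D) (val D') \/ reidemeister (val D) (val D').

Definition knot_equiv : gauss_diagram -> gauss_diagram -> Prop :=
  clos_refl_sym_trans gauss_diagram knot_step.

(* A virtual knot is an equivalence class of Gauss diagrams; the moves V1, V2,
   V3 and SV do not act on Gauss diagrams. *)
Record virtual_knot : Type := VirtualKnot {
  diagram_of :> gauss_diagram -> Prop;
  diagram_ofP : exists D, forall D', diagram_of D' <-> knot_equiv D D'
}.

Definition knot_of (D : gauss_diagram) : virtual_knot :=
  @VirtualKnot (knot_equiv D) (ex_intro _ D (fun D' => iff_refl _)).

Definition unknot : virtual_knot := knot_of empty_diagram.

(* [forbidden_path n D D'] : D can be transformed into D' using exactly n
   forbidden moves and any number of the moves generating [knot_equiv]. *)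
Inductive forbidden_path : nat -> gauss_diagram -> gauss_diagram -> Prop :=
| forbidden_path0 D D' : knot_equiv D D' -> forbidden_path 0 D D'
| forbidden_pathS n D D1 D2 D' :
    knot_equiv D D1 -> forbidden (val D1) (val D2) -> forbidden_path n D2 D' ->
    forbidden_path n.+1 D D'.

Definition is_minimum (P : nat -> Prop) (n : nat) : Prop :=
  P n /\ forall m, P m -> n <= m.

Definition is_crossing_number (K : virtual_knot) : nat -> Prop :=
  is_minimum (fun n => exists D, K D /\ arrow_count D = n).

Definition is_forbidden_number (K : virtual_knot) : nat -> Prop :=
  is_minimum
    (fun n => exists D D', [/\ K D, unknot D' & forbidden_path n D D']).

(* Main.v *)
Require Import Defs.
From mathcomp Require Import all_boot zify.
From Stdlib Require Import Relations Classical.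

Set Implicit Arguments.
Unset Strict Implicit.
Unset Printing Implicit Defensive.

(** A diagram is unknotted by deleting its arrows one at a time.  To delete an
    arrow, one of its endpoints is slid along the circle until it is next to
    the other one, and R1 removes the arrow.  Sliding past an endpoint of the
    same type is a single forbidden move.  Sliding past an endpoint of the other
    type costs two forbidden moves: R3 performs this exchange at the price of
    two further exchanges, one of tails and one of heads, against an auxiliary
    arrow which R2 supplies and takes back afterwards
    ([unknots_detour], [unknots_swap_mixed]).

    In a diagram with [c.+1] arrows, the two arcs between the ends of an arrow
    contain together [c] tails and [c] heads, so the two ways around the circle
    cost together [3 * c], and the cheaper one costs at most [(3 * c)./2]
    ([unknots_delete_half]).  This is the required amount when the number of
    arrows is odd.  When it is [m.*2.+2] with [m] positive, one more move than
    allowed is spent only if every endpoint of every arrow costs [3 * m + 1] one way and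
    [3 * m + 2] the other way; then all chords are diameters, and each of their
    arcs contains [m] endpoints of one type and [m.+1] of the other.  Fix one
    chord [f], and delete first, at cost [3 * m + 1], a chord that ends on an
    arc of [f] with the rarer type.  The arcs of [f] become so unbalanced
    that [f] can be deleted at cost [3 * m - 1], so that the two deletions cost
    [6 * m] together, as required ([unknots_even]). *)

(** * Words of Gauss diagrams *)

Lemma oppositeK : involutive opposite.
Proof. by case=> a b; rewrite /opposite /= negbK. Qed.

Lemma opposite_neq e : opposite e != e.
Proof. by apply/eqP; case: e => a [] []. Qed.

Lemma gauss_perm u v : perm_eq u v -> is_gauss u = is_gauss v.
Proof.
move=> uv; rewrite /is_gauss (perm_uniq (perm_map _ uv)) (perm_all _ uv).
by congr andb; apply: eq_all => e /=; rewrite (perm_mem uv).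
Qed.

Lemma gauss_uniq w : is_gauss w -> uniq w.
Proof. by case/andP=> /map_uniq. Qed.

Lemma gauss_opposite w e : is_gauss w -> e \in w -> opposite e \in w.
Proof. by case/andP=> _ /allP; apply. Qed.

Lemma gauss_delete e w : is_gauss (e :: opposite e :: w) -> is_gauss w.
Proof.
move=> g; have /= /and3P[] := gauss_uniq g; rewrite inE negb_or.
case/andP=> _ ew oew _; case/andP: (g) => /= /and3P[_ _ uw] _.
apply/andP; split=> //; apply/allP=> f fw /=.
have := gauss_opposite (e := f) g; rewrite !inE fw !orbT => /(_ isT).
case/or3P=> // /eqP fe; first by rewrite -fe oppositeK fw in oew.
by move/(can_inj oppositeK): fe ew => <-; rewrite fw.
Qed.

Lemma gauss_insert e w :
  label e.1 \notin [seq label f.1 | f <- w] -> is_gauss w ->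
  is_gauss (e :: opposite e :: w).
Proof.
move=> ew /andP[uw /allP ow]; apply/andP; split=> /=.
  have nw b : (label e.1, b) \notin [seq (label f.1, f.2) | f <- w].
    by apply: contra ew => /mapP[f fw [-> _]]; apply/mapP; exists f.
  by rewrite inE negb_or !nw uw xpair_eqE eqxx /= andbT; case: (e.2).
rewrite oppositeK !inE !eqxx !orbT /=; apply/allP=> f /ow /= of_w.
by rewrite !inE of_w !orbT.
Qed.

(** The map [opposite] permutes the letters and exchanges the two types. *)
Lemma gauss_half b w :
  is_gauss w -> (count [pred e : endpoint | e.2 != b] w).*2 = size w.
Proof.
move=> g; have oi := can_inj oppositeK.
have ow : perm_eq (map opposite w) w.
  apply: uniq_perm; rewrite ?map_inj_uniq ?gauss_uniq // => e.
  apply/mapP/idP=> [[f fw ->]|ew]; first exact: gauss_opposite.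
  by exists (opposite e); rewrite ?oppositeK //; exact: gauss_opposite.
rewrite -addnn -{2}(permP ow) count_map -(count_predC [pred e | e.2 != b] w).
by congr addn; apply: eq_count => e /=; case: e.2 b => -[].
Qed.

Lemma endpoint_split (e : endpoint) (w : seq endpoint) :
  e \in w -> exists s r : seq endpoint, w = s ++ e :: r.
Proof. by case/splitPr=> s r; exists s, r. Qed.

Lemma gauss_split e w :
  is_gauss (e :: w) -> exists s r, w = s ++ opposite e :: r.
Proof.
move=> g; have := gauss_opposite (e := e) g.
rewrite !inE eqxx (negPf (opposite_neq e)) /= => /(_ isT).
exact: endpoint_split.
Qed.

(** * Unknotting with a bounded number of forbidden moves *)

(** Speaking of words instead of [gauss_diagram] keeps validity proofs out of
    the computations.  Since the predicate implies [is_gauss w], and most moves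
    only permute the letters, validity has to be checked only where R1 and R2
    create or delete letters. *)
Definition unknots (n : nat) (w : seq endpoint) : Prop :=
  exists D D' m, [/\ val D = w, m <= n, unknot D' & forbidden_path m D D'].

Lemma unknots_gauss n w : unknots n w -> is_gauss w.
Proof. by case=> D [D' [m [<- _ _ _]]]; exact: (valP D). Qed.

Lemma perm_unknots_gauss n u v : perm_eq u v -> unknots n v -> is_gauss u.
Proof. by move/gauss_perm->; exact: unknots_gauss. Qed.

Lemma unknots_leq m n w : m <= n -> unknots m w -> unknots n w.
Proof.
move=> mn [D [D' [k [Dw km uD' p]]]].
by exists D, D', k; rewrite (leq_trans km).
Qed.

Lemma unknots_equiv n D D' :
  knot_equiv D D' -> unknots n (val D') -> unknots n (val D).
Proof.
move=> DD' [D1 [D2 [m [/val_inj D1E mn uD2 p]]]]; rewrite {}D1E {D1} in p.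
exists D, D2, m; split=> //.
case: p DD' => [A B AB DA|k A B C E AB BC p DA].
  by apply: forbidden_path0; apply: rst_trans DA AB.
by apply: forbidden_pathS BC p; apply: rst_trans DA AB.
Qed.

Lemma unknots_same n u v :
  is_gauss u -> same_diagram u v -> unknots n v -> unknots n u.
Proof.
move=> gu uv nv; have gv := unknots_gauss nv.
apply: (@unknots_equiv n (exist _ u gu) (exist _ v gv)) => //.
by apply: rst_step; left.
Qed.

Lemma unknots_reidemeister n u v :
  is_gauss u -> is_gauss v -> reidemeister u v -> unknots n u <-> unknots n v.
Proof.
move=> gu gv uv.
have DD' : knot_equiv (exist _ u gu) (exist _ v gv) by apply: rst_step; right.
split; first exact: (unknots_equiv (rst_sym _ _ _ _ DD')).
exact: (unknots_equiv DD').
Qed.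

Lemma unknots_forbidden n u v :
  is_gauss u -> forbidden u v -> unknots n v -> unknots n.+1 u.
Proof.
move=> gu uv [D [D' [m [Dv mn uD' p]]]]; exists (exist _ u gu), D', m.+1.
split=> //; apply: (@forbidden_pathS _ _ (exist _ u gu)) p; last by rewrite Dv.
exact: rst_refl.
Qed.

(** The moves are given with a prescribed base point; this lemma lets them act
    anywhere on the circle. *)
Lemma unknots_rot n u v : unknots n (u ++ v) <-> unknots n (v ++ u).
Proof.
have rot u1 u2 : unknots n (u1 ++ u2) -> unknots n (u2 ++ u1).
  move=> h; apply: unknots_same (Rotate _ _) (h).
  by apply: perm_unknots_gauss (h); rewrite perm_catC.
by split; exact: rot.
Qed.

Lemma unknots0 n : unknots n [::].
Proof.
exists empty_diagram, empty_diagram, 0; split=> //; first exact: rst_refl.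
by apply: forbidden_path0; exact: rst_refl.
Qed.

Lemma perm_in_order b c e f : perm_eq (in_order b e f) (in_order c e f).
Proof. by apply/permP=> a; case: b c => -[] //=; rewrite addnCA. Qed.

Lemma unknots_swap_tails n b x y u :
  unknots n (in_order (~~ b) (arrow_tail x) (arrow_tail y) ++ u) ->
  unknots n.+1 (in_order b (arrow_tail x) (arrow_tail y) ++ u).
Proof.
move=> h; apply: unknots_forbidden (h); last by case: b {h}; exact: FO.
by apply: perm_unknots_gauss (h); rewrite perm_cat2r perm_in_order.
Qed.

Lemma unknots_swap_heads n b x y p u :
  unknots n (p ++ in_order (~~ b) (arrow_head x) (arrow_head y) ++ u) ->
  unknots n.+1 (p ++ in_order b (arrow_head x) (arrow_head y) ++ u).
Proof.
move/unknots_rot; rewrite -catA => h; apply/unknots_rot; rewrite -catA.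
apply: unknots_forbidden (h); last by case: b {h}; exact: FU.
by apply: perm_unknots_gauss (h); rewrite perm_cat2r perm_in_order.
Qed.

(** The booleans choose which of the two new arrows comes first on each strand:
    equal orders give the parallel form of R2 and different orders the
    antiparallel form, so no choice is excluded.  This freedom is what allows
    [unknots_bigon] to meet the order constraints of R3. *)
Lemma unknots_R2 n y y' b c p q r :
  sgn y' = ~~ sgn y -> label y != label y' ->
  label y \notin [seq label f.1 | f <- p ++ q ++ r] ->
  label y' \notin [seq label f.1 | f <- p ++ q ++ r] ->
  unknots n (p ++ in_order b (arrow_tail y) (arrow_tail y') ++ q ++
               in_order c (arrow_head y) (arrow_head y') ++ r)
  <-> unknots n (p ++ q ++ r).
Proof.
move=> sy yy' fy fy'.
set W := p ++ in_order _ _ _ ++ _.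
have pW : perm_eq W (arrow_tail y :: arrow_head y ::
                     arrow_tail y' :: arrow_head y' :: p ++ q ++ r).
  by apply/permP=> a; rewrite {}/W !count_cat; case: b c => -[] /=;
    rewrite ?count_cat; lia.
suff key : is_gauss (p ++ q ++ r) -> unknots n (p ++ q ++ r) <-> unknots n W.
  split=> h.
    apply/key=> //; have := unknots_gauss h; rewrite (gauss_perm pW).
    by move/(@gauss_delete (arrow_tail y))/(@gauss_delete (arrow_tail y')).
  by apply/key => //; exact: unknots_gauss h.
move=> g; have gW : is_gauss W.
  rewrite (gauss_perm pW); apply: (@gauss_insert (arrow_tail y)).
    by rewrite /= !inE !negb_or yy' fy.
  exact: (@gauss_insert (arrow_tail y')).
rewrite /W !(unknots_rot n p) -!catA.
move: g gW; rewrite /W !(gauss_perm (permEl (perm_catC p _))) -!catA => g gW.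
apply: unknots_reidemeister => //.
case: b c {W pW gW} => -[] /=.
- exact: R2_parallel.
- exact: R2_antiparallel.
- by apply: (@R2_antiparallel y' y); rewrite sy negbK.
- by apply: (@R2_parallel y' y); rewrite sy negbK.
Qed.

(** * Exchanging a head with an adjacent tail *)

Lemma fresh_label (w : seq endpoint) :
  exists l, forall k, l <= k -> k \notin [seq label f.1 | f <- w].
Proof.
exists (\sum_(i <- [seq label f.1 | f <- w]) i).+1 => k lk.
apply/negP=> kw; move: lk; rewrite (big_rem k) //=; lia.
Qed.

(** The pair of arrows [y], [y'] is created by R2 in such a way that [y] is
    adjacent to the tail of [x] and to the head of [z], on the sides demanded by
    the top and bottom strands of R3; [y'] then lies beyond [y].  Whether it
    ends up after or before the strand depends on that side, whence the two
    complementary [nseq] with zero or one letter around each strand. *)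
Lemma unknots_bigon n h x y y' z q1 q2 :
  let bt := h (+) sgn y in let bb := h (+) sgn x (+) sgn y (+) sgn z in
  let t := arrow_tail y' in let d := arrow_head y' in
  sgn y' = ~~ sgn y -> label y != label y' ->
  label y \notin
    [seq label f.1 | f <- arrow_tail x :: q1 ++ arrow_head z :: q2] ->
  label y' \notin
    [seq label f.1 | f <- arrow_tail x :: q1 ++ arrow_head z :: q2] ->
  unknots n (top_strand h x y z ++ (nseq bt t ++ q1 ++ nseq bb d) ++
             bottom_strand h x y z ++ (nseq (~~ bb) d ++ q2 ++ nseq (~~ bt) t))
  <-> unknots n (arrow_tail x :: q1 ++ arrow_head z :: q2).
Proof.
move=> bt bb t d sy yy' fy fy'; rewrite /top_strand /bottom_strand -/bt -/bb.
have R2 b c p q r : p ++ q ++ r = arrow_tail x :: q1 ++ arrow_head z :: q2 ->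
    unknots n (p ++ in_order b (arrow_tail y) t ++ q ++
                 in_order c (arrow_head y) d ++ r)
    <-> unknots n (arrow_tail x :: q1 ++ arrow_head z :: q2).
  by move=> E; rewrite -E; apply: unknots_R2; rewrite ?E.
have rot_t v : unknots n (t :: v) <-> unknots n (v ++ [:: t]).
  exact: (unknots_rot n [:: t]).
case: bt bb => -[] /=; rewrite ?cats0 -?catA.
- exact: (R2 true false [:: arrow_tail x] q1).
- rewrite -(R2 true true [:: arrow_tail x] (rcons q1 (arrow_head z)) q2) /=.
    by rewrite !cat_rcons.
  by rewrite cat_rcons.
- rewrite -(R2 false false [::] (arrow_tail x :: q1) (arrow_head z :: q2)) //=.
  by rewrite rot_t /= -?catA /= -?catA.
- rewrite -(R2 false true [::] (arrow_tail x :: rcons q1 (arrow_head z)) q2) /=.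
    by rewrite rot_t /= ?cat_rcons -?catA /= -?catA /= -?catA.
  by rewrite cat_rcons.
Qed.

(** Create the bigon, apply R3, undo the exchanges of R3 on the top and bottom
    strands by one FO and one FU, and remove the bigon: only the effect of R3 on
    the middle strand remains.  The middle strand does not involve [y]; it is
    hidden in [q1] or [q2], according to the cyclic order of the three strands,
    and the hypothesis says that R3 takes [q1], [q2] to [q1'], [q2']. *)
Lemma unknots_detour n h x z q1 q2 q1' q2' :
  (forall y a1 b1 b2 a2,
     reidemeister
       (top_strand h x y z ++ (a1 ++ q1 ++ b1) ++
          bottom_strand h x y z ++ (b2 ++ q2 ++ a2))
       (top_strand (~~ h) x y z ++ (a1 ++ q1' ++ b1) ++
          bottom_strand (~~ h) x y z ++ (b2 ++ q2' ++ a2))) ->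
  perm_eq (q1 ++ q2) (q1' ++ q2') ->
  unknots n (arrow_tail x :: q1' ++ arrow_head z :: q2') ->
  unknots n.+2 (arrow_tail x :: q1 ++ arrow_head z :: q2).
Proof.
move=> R3 pq nq'.
set W' := _ :: _ ++ _ in nq'; set W := _ :: _ ++ _.
have pW : perm_eq W W'.
  apply/permP=> a; have := permP pq a; rewrite /= !count_cat /= ; lia.
have [l fl] := fresh_label W.
have fl' k : l <= k -> k \notin [seq label f.1 | f <- W'].
  by move/fl; rewrite (perm_mem (perm_map _ pW)).
(* for either sign of y, the bigon is inserted on the sides that R3 demands *)
pose y : arrow := (l, true); pose y' : arrow := (l.+1, false).
have yy' : label y != label y' by rewrite neq_ltn ltnSn.
apply/(@unknots_bigon _ h x y y' z) => //; try exact: fl.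
move/(@unknots_bigon _ h x y y' z): nq' => nq'.
move: {nq'}(nq' (erefl _) yy' (fl' _ (leqnn l)) (fl' _ (leqnSn l))).
set a1 := nseq _ _; set b1 := nseq _ _; set b2 := nseq _ _; set a2 := nseq _ _.
move=> nq'; have {}R3 := R3 y a1 b1 b2 a2.
set V := _ ++ _ ++ _ ++ _ ++ _ in R3; set V' := _ ++ _ ++ _ ++ _ ++ _ in R3.
(* one FO and one FU lead from V' back to the word with the bigon *)
have nV' : unknots n.+2 V'.
  rewrite /V' /top_strand /bottom_strand !addNb.
  apply: unknots_swap_tails; rewrite catA.
  by apply: unknots_swap_heads; rewrite -catA !negbK.
have pV : perm_eq V V'.
  apply/permP=> a; have := permP pq a.
  rewrite !count_cat !(permP (perm_in_order _ true _ _)); lia.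
have gV := perm_unknots_gauss pV nV'.
exact/(unknots_reidemeister _ gV (unknots_gauss nV') R3).
Qed.

(** Here [h] is [b (+) sgn z], the value for which the middle strand of R3 reads
    the head of [x] and the tail of [z] in the order [b].  The two cases are the
    two cyclic orders of the three strands. *)
Lemma unknots_swap_mixed n b x z r :
  x != z ->
  unknots n (in_order (~~ b) (arrow_head x) (arrow_tail z) ++ r) ->
  unknots n.+2 (in_order b (arrow_head x) (arrow_tail z) ++ r).
Proof.
move=> xz nr; set m := in_order b _ _.
have g : is_gauss (m ++ r).
  by apply: perm_unknots_gauss nr; rewrite perm_cat2r perm_in_order.
have sides e :
    e \in m ++ r -> e != arrow_head x -> e != arrow_tail z -> e \in r.
  move=> + /negPf ex /negPf ez; rewrite mem_cat.
  by rewrite (perm_mem (perm_in_order _ true _ _)) !inE ex ez.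
have xm : arrow_tail x \in r.
  apply: sides; rewrite ?xpair_eqE ?andbF ?(negPf xz) //.
  apply: (@gauss_opposite _ (arrow_head x)) => //.
  by rewrite mem_cat (perm_mem (perm_in_order _ true _ _)) !inE eqxx.
have zm : arrow_head z \in r.
  apply: sides; rewrite ?xpair_eqE ?andbF ?(eq_sym z) ?(negPf xz) //.
  apply: (@gauss_opposite _ (arrow_tail z)) => //.
  by rewrite mem_cat (perm_mem (perm_in_order _ true _ _)) !inE eqxx orbT.
have midE c y :
    middle_strand (c (+) sgn z) x y z =
      in_order c (arrow_head x) (arrow_tail z).
  by rewrite /middle_strand addbK.
case/splitPr: xm zm nr => r1 r2; rewrite mem_cat inE xpair_eqE andbF /=.
case/orP=> /splitPr[u v] nr.
- have rot k M : unknots k (M ++ (u ++ arrow_head z :: v) ++ arrow_tail x :: r2)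
      <-> unknots k (arrow_tail x :: (r2 ++ M ++ u) ++ arrow_head z :: v).
    have := unknots_rot k (M ++ u ++ arrow_head z :: v) (arrow_tail x :: r2).
    by rewrite /= -!catA.
  rewrite rot; move/rot: nr; apply: (@unknots_detour _ (b (+) sgn z)).
    move=> y a1 b1 b2 a2.
    have := R3_tmb (b (+) sgn z) x y z (a1 ++ r2) (u ++ b1) (b2 ++ v ++ a2).
    by rewrite -addNb !midE -!catA.
  by rewrite perm_cat2r perm_cat2l perm_cat2r perm_in_order.
- have rot k M : unknots k (M ++ r1 ++ arrow_tail x :: u ++ arrow_head z :: v)
      <-> unknots k (arrow_tail x :: u ++ arrow_head z :: v ++ M ++ r1).
    have := unknots_rot k (M ++ r1) (arrow_tail x :: u ++ arrow_head z :: v).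
    by rewrite /= -!catA.
  rewrite rot; move/rot: nr; apply: (@unknots_detour _ (b (+) sgn z)).
    move=> y a1 b1 b2 a2.
    have := R3_tbm (b (+) sgn z) x y z (a1 ++ u ++ b1) (b2 ++ v) (r1 ++ a2).
    by rewrite -addNb !midE -!catA.
  by rewrite !perm_cat2l perm_cat2r perm_in_order.
Qed.

(** * Deleting an arrow *)

(** The endpoints that [e] has to pass cost one each if they have its type and
    two each otherwise. *)
Definition slide_cost (e : endpoint) (s : seq endpoint) : nat :=
  size s + count [pred f : endpoint | f.2 != e.2] s.

Lemma unknots_swap n p a b r :
  b != opposite a -> unknots n (p ++ b :: a :: r) ->
  unknots (n + slide_cost a [:: b]) (p ++ a :: b :: r).
Proof.
move=> ba; rewrite !(unknots_rot _ p) /slide_cost /= addn0.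
case: a b ba => [x []] [z []] /= xz h; rewrite ?addn0 ?addn1 ?addn2.
- exact: (unknots_swap_tails (b := true)) h.
- apply: (unknots_swap_mixed (b := false)) h.
  by apply: contra xz => /eqP ->.
- apply: (unknots_swap_mixed (b := true)) h.
  by apply: contra xz => /eqP ->.
- exact: (unknots_swap_heads (b := true) (p := [::])) h.
Qed.

Lemma slide_cost_cat e s r :
  slide_cost e (s ++ r) = slide_cost e s + slide_cost e r.
Proof. by rewrite /slide_cost size_cat count_cat addnACA. Qed.

Lemma unknots_slide_right n p e s r :
  opposite e \notin s -> unknots n (p ++ s ++ e :: r) ->
  unknots (n + slide_cost e s) (p ++ e :: s ++ r).
Proof.
elim: s p => [|f s IH] p /=; first by rewrite addn0.
rewrite inE negb_or -[f :: s]cat1s slide_cost_cat addnA addnAC.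
case/andP=> ef es h.
apply: unknots_swap; first by rewrite eq_sym.
by rewrite -cat_rcons; apply: IH; rewrite // cat_rcons.
Qed.

Lemma unknots_slide_left n p e s r :
  opposite e \notin s -> unknots n (p ++ e :: s ++ r) ->
  unknots (n + slide_cost e s) (p ++ s ++ e :: r).
Proof.
elim: s n p => [|f s IH] n p /=; first by rewrite addn0.
rewrite inE negb_or -[f :: s]cat1s slide_cost_cat addnA => /andP[ef es] h.
rewrite -cat_rcons; apply: IH; rewrite // cat_rcons.
have -> : slide_cost e [:: f] = slide_cost f [:: e].
  by rewrite /slide_cost /= eq_sym.
by apply: unknots_swap h; apply: contra ef => /eqP ->; rewrite oppositeK.
Qed.

Lemma perm_chord e s r :
  perm_eq (e :: s ++ opposite e :: r) (e :: opposite e :: s ++ r).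
Proof. by rewrite perm_cons perm_catC /= perm_cons perm_catC. Qed.

Lemma gauss_chord e s r :
  is_gauss (e :: s ++ opposite e :: r) ->
  [/\ is_gauss (s ++ r), opposite e \notin s & opposite e \notin r].
Proof.
rewrite (gauss_perm (perm_chord e s r)) => g; split.
  exact: gauss_delete g.
  by have /= /and3P[_] := gauss_uniq g; rewrite mem_cat negb_or => /andP[].
by have /= /and3P[_] := gauss_uniq g; rewrite mem_cat negb_or => /andP[].
Qed.

Lemma unknots_R1 n e u w :
  perm_eq (e :: opposite e :: u) w -> is_gauss w -> unknots n u ->
  unknots n (e :: opposite e :: u).
Proof.
move/gauss_perm=> <- g h; have gu := unknots_gauss h.
exact/(unknots_reidemeister n gu g (R1 e u)).
Qed.

Lemma unknots_delete n e s r :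
  is_gauss (e :: s ++ opposite e :: r) -> unknots n (s ++ r) ->
  unknots (n + minn (slide_cost e s) (slide_cost e r))
    (e :: s ++ opposite e :: r).
Proof.
move=> g; rewrite unknots_rot => h; have [gsr es er] := gauss_chord g.
case: leqP => _.
  apply: (@unknots_slide_right _ [::]) => //=.
  rewrite unknots_rot /=; apply: unknots_R1 g h.
  by rewrite perm_sym (permPl (perm_chord e s r)) 2!perm_cons perm_catC.
apply/(unknots_rot _ [:: e] (s ++ _)).
rewrite -catA /= -(cat_rcons (opposite e)).
apply: unknots_slide_left => //; rewrite cats0 cat_rcons unknots_rot /=.
rewrite -[X in [:: _, X & _]]oppositeK; apply: unknots_R1 g h.
rewrite oppositeK perm_sym (permPl (perm_chord e s r)).
by rewrite -(cat1s (opposite e)) (perm_catCA [:: e]) 2!perm_cons perm_catC.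
Qed.

(** The two ways around the circle pass [c] endpoints of each type, for a cost
    of [c + 2 * c]. *)
Lemma slide_cost_sum c e s r :
  is_gauss (s ++ r) -> size (s ++ r) = c.*2 ->
  slide_cost e s + slide_cost e r = 3 * c.
Proof.
move=> g sz; rewrite -slide_cost_cat /slide_cost sz.
by have := gauss_half e.2 g; rewrite sz; lia.
Qed.

Lemma slide_cost_opposite e s :
  slide_cost e s + slide_cost (opposite e) s = 3 * size s.
Proof.
rewrite /slide_cost -(count_predC [pred f : endpoint | f.2 != e.2] s).
have -> : count (predC [pred f : endpoint | f.2 != e.2]) s =
          count [pred f : endpoint | f.2 != (opposite e).2] s.
  by apply: eq_count => f /=; case: (f.2) (e.2) => -[].
lia.
Qed.

Lemma unknots_delete_half n c e s r :
  is_gauss (e :: s ++ opposite e :: r) -> size (s ++ r) = c.*2 ->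
  unknots n (s ++ r) -> unknots (n + (3 * c)./2) (e :: s ++ opposite e :: r).
Proof.
move=> g sz h; apply: unknots_leq (unknots_delete g h).
by have := slide_cost_sum e (unknots_gauss h) sz; lia.
Qed.

(** * Deleting all arrows *)

(** This is the bound of the theorem except that it is 0 rather than 1 for at
    most one arrow.  The recurrence needs this: a diagram with two arrows spends
    its single forbidden move on the first deletion. *)
Definition bound (c : nat) : nat := 3 * (c./2 * c.-1./2) + (1 < c).

Lemma bound_odd m : 0 < m -> bound m.*2.+1 = bound m.*2 + 3 * m.
Proof.
case: m => // m _; rewrite /bound /= !doubleK uphalf_double /=; nia.
Qed.

Lemma bound_even m : 0 < m -> bound m.*2.+2 = bound m.*2.+1 + 3 * m.
Proof.
by case: m => // m _; rewrite /bound /= !doubleK uphalf_double /=; nia.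
Qed.

Lemma bound_leq c : bound c <= (3 * c ^ 2 + 7 - 6 * c) %/ 4.
Proof.
rewrite leq_divRL // /bound -(odd_double_half c).
case: (odd c); case: (c./2) => [|k] //.
  by rewrite add1n /= !doubleK uphalf_double /= ; nia.
by rewrite add0n /= !doubleK uphalf_double /= ; nia.
Qed.

(** When [m.*2.+2] arrows are present, the budget for one deletion is [3 * m],
    while half of the total cost [3 * m.*2.+1] is [3 * m + 1].  Either some
    chord can be deleted within the budget, or the balanced configuration in
    which all chords are diameters appears and two deletions are taken
    together. *)
Lemma unknots_even m w :
    0 < m ->
    (forall v, is_gauss v -> size v = m.*2.*2 -> unknots (bound m.*2) v) ->
    (forall v, is_gauss v -> size v = m.*2.+1.*2 ->
       unknots (bound m.*2.+1) v) ->
  is_gauss w -> size w = m.*2.+2.*2 -> unknots (bound m.*2.+2) w.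
Proof.
move=> m0 IH2 IH1 g sz; apply: NNPP => nw.
pose alike v :=
  [/\ is_gauss v, size v = m.*2.+2.*2 & forall n, unknots n v -> unknots n w].
have rot p q : alike (p ++ q) -> alike (q ++ p).
  rewrite /alike (gauss_perm (permEl (perm_catC p q))) !size_cat addnC.
  by case=> gv sv nv; split=> // n; rewrite unknots_rot; exact: nv.
have heavy e s r : alike (e :: s ++ opposite e :: r) ->
    (3 * m < slide_cost e s) && (3 * m < slide_cost e r).
  case=> gv sv nv; rewrite ltnNge (ltnNge _ (slide_cost e r)) -negb_or -geq_min.
  apply/negP=> le3m; apply/nw/nv; rewrite bound_even //.
  have [gsr _ _] := gauss_chord gv.
  have /IH1 h : size (s ++ r) = m.*2.+1.*2.
    by move: sv; rewrite /= !size_cat /=; lia.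
  by apply: unknots_leq (unknots_delete gv (h gsr)); rewrite leq_add2l.
(* The costs of e and of its opposite along s add up to 3 * size s, so that the
   lower bounds force both arcs to have more than m.*2 endpoints. *)
have long e s r : alike (e :: s ++ opposite e :: r) ->
    size s = m.*2.+1 /\ size r = m.*2.+1.
  move=> ev; have /andP[hs hr] := heavy _ _ _ ev.
  have /andP[hr' hs'] : (3 * m < slide_cost (opposite e) r) &&
                        (3 * m < slide_cost (opposite e) s).
    by apply: heavy; rewrite oppositeK; exact: (rot (e :: s) (_ :: r)).
  have [_ + _] := ev; rewrite /= size_cat /=.
  by have := slide_cost_opposite e s; have := slide_cost_opposite e r; lia.
have [f [s [r fsr]]] : exists f s r, alike (f :: s ++ opposite f :: r).
  have [f [w' Dw]] : exists f w', w = f :: w'.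
    by case: (w) sz => [|f w' _]; [rewrite doubleS | exists f, w'].
  have gw := g; rewrite Dw in gw; have [s [r E]] := gauss_split gw.
  by exists f, s, r; rewrite -E -Dw.
have [gf _ _] := fsr; have [ss sr] := long _ _ _ fsr.
have /andP[hs hr] := heavy _ _ _ fsr; have [gsr fs fr] := gauss_chord gf.
have sum := slide_cost_sum (c := m.*2.+1) f gsr.
have {}sum : slide_cost f s + slide_cost f r = 3 * m.*2.+1.
  by apply: sum; rewrite size_cat; lia.
pose B := count [pred k : endpoint | k.2 != f.2] s.
have Bs : slide_cost f s = size s + B by [].
(* The arc s contains B endpoints of the type opposite to that of f, and B is m
   or m.+1; k is taken of the rarer type, which occurs because m > 0. *)
have [k ks kt] :
    exists2 k, k \in s & (k.2 != f.2) = (B == m).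
  suff /hasP[k ks /eqP kt] : has [pred k | (k.2 != f.2) == (B == m)] s.
    by exists k.
  rewrite has_count.
  have := count_predC [pred k : endpoint | k.2 != f.2] s; rewrite -/B => cs.
  have [Bm|Bm] := eqVneq B m.
    rewrite (eq_count (a2 := [pred k : endpoint | k.2 != f.2])) -/B; first lia.
    by move=> k /=; rewrite eqb_id.
  rewrite (eq_count (a2 := predC [pred k : endpoint | k.2 != f.2])); first lia.
  by move=> k /=; rewrite eqbF_neg.
have [s1 [s2 Ds]] := endpoint_split ks.
(* The chord of k crosses that of f, since otherwise it would cut off an arc
   shorter than that of a diameter. *)
have s1k : opposite k \notin s1.
  apply/negP=> /endpoint_split[a [b Es]]; rewrite Es in Ds.
  have [] := long (opposite k) b (s2 ++ opposite f :: r ++ f :: a).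
    have := rot (f :: a) (opposite k :: b ++ k :: s2 ++ opposite f :: r).
    rewrite oppositeK /= -?catA /= -?catA /=; apply.
    by rewrite Ds -!catA /= -?catA in fsr.
  by move: ss; rewrite Ds !size_cat /= ?size_cat /=; clear; lia.
have s2k : opposite k \notin s2.
  apply/negP=> /endpoint_split[a [b Es]]; rewrite Es in Ds.
  have [] := long k a (b ++ opposite f :: r ++ f :: s1).
    have := rot (f :: s1) (k :: a ++ opposite k :: b ++ opposite f :: r).
    rewrite /= -?catA /= -?catA /=; apply.
    by rewrite Ds -!catA /= -?catA in fsr.
  by move: ss; rewrite Ds !size_cat /= ?size_cat /=; clear; lia.
have kr : opposite k \in r.
  have := gauss_opposite (e := k) gf.
  rewrite !(inE, mem_cat) ks orbT => /(_ isT).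
  rewrite Ds !(inE, mem_cat) (negPf s1k) (negPf s2k).
  rewrite (negPf (opposite_neq k)) /=.
  case/or3P=> // /eqP E; first by rewrite -E oppositeK ks in fs.
  have /= /andP[] := gauss_uniq gf.
  by rewrite -(can_inj oppositeK E) mem_cat ks.
have [r1 [r2 Dr]] := endpoint_split kr.
(* Delete the chord of k; the word X that remains still contains that of f. *)
have fk :
    alike (k :: (s2 ++ opposite f :: r1) ++ opposite k :: (r2 ++ f :: s1)).
  have := rot (f :: s1) (k :: (s2 ++ opposite f :: r1) ++ opposite k :: r2).
  by rewrite /= -?catA /= -?catA /=; apply; rewrite Ds Dr -!catA /= in fsr.
have [gk sk nk] := fk; have [gX _ _] := gauss_chord gk.
apply/nw/nk; set X := _ ++ _ in gX.
have sX : size X = m.*2.+1.*2.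
  by move: sk; rewrite /X /= !size_cat /= ?size_cat /=; clear; lia.
have XE n :
    unknots n X <-> unknots n (f :: (s1 ++ s2) ++ opposite f :: r1 ++ r2).
  have := unknots_rot n (s2 ++ opposite f :: r1 ++ r2) (f :: s1).
  by rewrite /X /= -?catA /= -?catA.
have gY : is_gauss (f :: (s1 ++ s2) ++ opposite f :: r1 ++ r2).
  rewrite -(gauss_perm (u := X)) //.
  have := permEl (perm_catC (s2 ++ opposite f :: r1 ++ r2) (f :: s1)).
  by rewrite /X /= -?catA /= -?catA.
have [gZ _ _] := gauss_chord gY; have := IH2 _ gZ.
have sZ : size ((s1 ++ s2) ++ r1 ++ r2) = m.*2.*2.
  by move: sX; rewrite /X !size_cat /= ?size_cat /=; clear; lia.
move/(_ sZ)/(unknots_delete gY)/XE/(unknots_delete_half gk sX).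
apply: unknots_leq; rewrite bound_even // bound_odd //.
have := slide_cost_sum f gZ sZ.
(* Without k the arc has m - 1 and m + 1 endpoints of the two types, so one of
   the two ways for f costs 3 * m - 1. *)
have : slide_cost f (s1 ++ s2) = m.*2 + (B - (B == m)).
  rewrite /B -kt {1}Ds /slide_cost size_cat !count_cat /=.
  rewrite [X in _ + (X - _)]addnCA addKn.
  by move: ss; rewrite Ds size_cat /=; clear; lia.
move: m0 Bs ss hs hr sum; clear; case: eqVneq => [->|]; lia.
Qed.

Lemma unknots_bound c w :
  is_gauss w -> size w = c.*2 -> unknots (bound c) w.
Proof.
elim/ltn_ind: c w => c IH w g sz.
case: w g sz => [|e w] g sz; first exact: unknots0.
have [s [r E]] := gauss_split g; rewrite {}E {w} in g sz *.
case: c IH sz => // c IH sz.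
have [gsr _ _] := gauss_chord g.
have ssr : size (s ++ r) = c.*2.
  by move: sz; rewrite /= !size_cat /=; lia.
have := unknots_delete_half g ssr (IH c (ltnSn c) _ gsr ssr).
rewrite -(odd_double_half c) in IH sz *.
case: (odd c) IH sz => IH sz; case: (posnP c./2) IH sz => [->|m0] IH sz //.
  move=> _; apply: unknots_even; rewrite ?add1n // => v gv sv; apply: IH => //.
by apply: unknots_leq; rewrite add0n bound_odd //; lia.
Qed.

(** * The forbidden number *)

Lemma is_minimum_exists (P : nat -> Prop) n :
  P n -> exists2 k, is_minimum P k & k <= n.
Proof.
elim/ltn_ind: n => n IH Pn.
have [[k [kn Pk]]|nP] := classic (exists k, k < n /\ P k).
  by have [j Pj jk] := IH k kn Pk; exists j; rewrite // (leq_trans jk) // ltnW.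
exists n => //; split=> // k Pk; rewrite leqNgt; apply/negP=> kn.
by apply: nP; exists k.
Qed.

(* The subtraction is exact: 6 * c <= 3 * c ^ 2 + 7 for every c. *)
Theorem theorem5 (K : virtual_knot) (c : nat) :
  is_crossing_number K c ->
  exists F : nat,
    is_forbidden_number K F /\ F <= (3 * c ^ 2 + 7 - 6 * c) %/ 4.
Proof.
case=> [[D [KD Dc]] _].
have sD : size (val D) = c.*2.
  rewrite -(gauss_half false (valP D)) -Dc /arrow_count.
  by congr double; apply: eq_count => e /=; case: e.2.
have [D1 [D' [n [/val_inj D1E nc uD' p]]]] := unknots_bound (valP D) sD.
rewrite {}D1E in p.
have [F minF Fn] := @is_minimum_exists (fun n => exists D D',
  [/\ K D, unknot D' & forbidden_path n D D']) n
  (ex_intro _ D (ex_intro _ D' (And3 KD uD' p))).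
exists F; split=> //.
exact: leq_trans (leq_trans Fn nc) (bound_leq c).
Qed.
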